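(* Suppose $Y^*\in\mathcal L^1(\mathcal Q)$, $\rho_{\mathcal Q}$ is continuous from above at $0$, and assumption (A) holds: there exists $\lambda\in(0,1)$ such that for all $\tau_1,\tau_2\in\mathcal T_f\setminus\{0\}$, $$\inf_{A\in\mathcal F_{\tau_1\wedge\tau_2}}\rho_{\mathcal Q}\big((\mathbb 1_A-\lambda)(Y_{\tau_2}-Y_{\tau_1})\big)\le0.$$ Then $$\sup_{\tau\in\mathcal T}\inf_{\mathrm Q\in\mathcal Q}\mathbb E_{\mathrm Q}[Y_\tau]=\sup_{\tau\in\mathcal T}\inf_{\mathrm Q\in co(\mathcal Q)}\mathbb E_{\mathrm Q}[Y_\tau]=\inf_{\mathrm Q\in co(\mathcal Q)}\sup_{\tau\in\mathcal T}\mathbb E_{\mathrm Q}[Y_\tau].$$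
   Context: Let $0<T<\infty$ and let $(\Omega,\mathcal F,(\mathcal F_t)_{0\le t\le T},\mathrm P)$ be a filtered probability space with right-continuous filtration, $\mathcal F=\mathcal F_T$, and $\mathcal F_0$ containing only sets of probability $0$ or $1$ as well as all $\mathrm P$-null sets of $\mathcal F_T$. $\mathcal T$ denotes the set of all stopping times $\tau\le T$ w.r.t. $(\mathcal F_t)$, and $\mathcal T_f$ the set of those with finite range; $\mathcal T_f\setminus\{0\}$ excludes the stopping time identically $0$. $\mathcal Q$ is a nonempty set of probability measures on $\mathcal F$, each absolutely continuous w.r.t. $\mathrm P$, and $co(\mathcal Q)$ is its convex hull. $\mathcal L^1(\mathcal Q)$ is the set of random variables $X$ with $\sup_{\mathrm Q\in\mathcal Q}\mathbb E_{\mathrm Q}[|X|]<\infty$. $Y=(Y_t)_{0\le t\le T}$ is a right-continuous $(\mathcal F_t)$-adapted process with bounded paths which is quasi left-uppersemicontinuous w.r.t. $\mathrm P$, i.e. $\limsup_n Y_{\tau_n}\le Y_\tau$ $\mathrm P$-a.s. whenever $\tau_n\in\mathcal T$, $\tau_n\nearrow\tau\in\mathcal T$. $Y^*:=\sup_{t\in[0,T]}|Y_t|$. $\mathcal X$ is the set of random variables $X$ with $|X|\le C(Y^*+1)$ $\mathrm P$-a.s. for some $C>0$, and $\rho_{\mathcal Q}:\mathcal X\to\mathbb R$, $\rho_{\mathcal Q}(X)=\sup_{\mathrm Q\in\mathcal Q}\mathbb E_{\mathrm Q}[X]$. $\rho_{\mathcal Q}$ is called continuous from above at $0$ if $\rho_{\mathcal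 Q}(X_n)\searrow0$ whenever $X_n\in\mathcal X$ and $X_n\searrow0$ $\mathrm P$-a.s. *)

(* Defs.v *)
From HB Require Import structures.
From mathcomp Require Import all_boot all_order all_algebra.
From mathcomp Require Import all_classical all_reals all_analysis.
Set Implicit Arguments. Unset Strict Implicit. Unset Printing Implicit Defensive.
Import Order.TTheory GRing.Theory Num.Theory.
Import numFieldNormedType.Exports.
Local Open Scope classical_set_scope.
Local Open Scope ring_scope.

Section defs.
Context {d : measure_display} {Omega : measurableType d} {R : realType}.

Definition filtration (T : R) (F : R -> set (set Omega)) : Prop :=
  (forall t, 0 <= t <= T -> sigma_algebra setT (F t)) /\
  (forall t, 0 <= t <= T -> F t `<=` measurable) /\
  (forall s t, 0 <= s -> s <= t -> t <= T -> F s `<=` F t).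

Definition right_continuous_filtration (T : R) (F : R -> set (set Omega)) : Prop :=
  forall t, 0 <= t < T -> F t = [set A | forall s, t < s <= T -> F s A].

Definition stopping_time (T : R) (F : R -> set (set Omega)) (tau : Omega -> R) : Prop :=
  (forall w, 0 <= tau w <= T) /\
  (forall t, 0 <= t <= T -> F t [set w | tau w <= t]).

Definition finite_stopping_time T F (tau : Omega -> R) : Prop :=
  stopping_time T F tau /\ finite_set (range tau).

Definition stopped_sigma (T : R) (F : R -> set (set Omega)) (tau : Omega -> R)
  : set (set Omega) :=
  [set A | measurable A /\
           forall t, 0 <= t <= T -> F t (A `&` [set w | tau w <= t])].

Definition stopped (Y : R -> Omega -> R) (tau : Omega -> R) : Omega -> R :=
  fun w => Y (tau w) w.

Definition Ystar (T : R) (Y : R -> Omega -> R) : Omega -> R :=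
  fun w => sup [set `|Y t w| | t in `[0, T]].

Definition abs_cont (Q P : probability Omega R) : Prop :=
  forall A, measurable A -> P A = 0%E -> Q A = 0%E.

Definition co (QQ : set (probability Omega R)) : set (probability Omega R) :=
  [set mu | exists n (w : 'I_n -> R) (Qs : 'I_n -> probability Omega R),
     (forall i, 0 <= w i) /\ \sum_(i < n) w i = 1 /\ (forall i, QQ (Qs i)) /\
     forall A, measurable A -> mu A = (\sum_(i < n) (w i)%:E * Qs i A)%E].

Definition rhoQ (QQ : set (probability Omega R)) (X : Omega -> R) : \bar R :=
  ereal_sup [set (\int[Q]_w (X w)%:E)%E | Q in QQ].

Definition in_L1 (QQ : set (probability Omega R)) (X : Omega -> R) : Prop :=
  (ereal_sup [set (\int[Q]_w (`|X w|)%:E)%E | Q in QQ] < +oo)%E.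

Definition Xset (P : probability Omega R) (T : R) (Y : R -> Omega -> R)
  : set (Omega -> R) :=
  [set X : Omega -> R | measurable_fun setT X /\
     exists C : R, 0 < C /\ {ae P, forall w, `|X w| <= C * (Ystar T Y w + 1)}].

Definition cont_from_above_at0 (P : probability Omega R) (T : R)
  (Y : R -> Omega -> R) (QQ : set (probability Omega R)) : Prop :=
  forall Xn : nat -> Omega -> R,
    (forall n, Xset P T Y (Xn n)) ->
    {ae P, forall w, (forall n, Xn n.+1 w <= Xn n w) /\ Xn n w @[n --> \oo] --> 0} ->
    (forall n, (rhoQ QQ (Xn n.+1) <= rhoQ QQ (Xn n))%E) /\
    rhoQ QQ (Xn n) @[n --> \oo] --> 0%E.

End defs.

(* Main.v *)
Require Import Defs.
From HB Require Import structures.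
From mathcomp Require Import all_boot all_order all_algebra.
From mathcomp Require Import all_classical all_reals all_analysis.
From mathcomp Require Import measurable_realfun ring lra.
Import Order.TTheory GRing.Theory Num.Theory.
Import numFieldNormedType.Exports.
Local Open Scope classical_set_scope.
Local Open Scope ring_scope.
Set Implicit Arguments. Unset Strict Implicit. Unset Printing Implicit Defensive.

(** Call [g] attainable if, up to any error, some stopped payoff [Y_tau] has at
    least the expectation of [g] under all [Q] in [QQ] simultaneously.
    Pasting stopping times along the sets given by (A) (applied to the swapped
    pair) makes the attainable payoffs stable under [(g, h) |-> (1 - lam) g + lam h].
    For finitely many [Q] this yields a minimax theorem, by a descent argument
    on the squared shortfalls.
    To pass to all [Q] at once, take among the payoffs feasible for a well chosen
    finite set of [Q]'s one, [g], of almost minimal weighted L2(P)-norm: adding any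
    further [Q] hardly changes the minimal norm, so by the parallelogram identity
    [g] is L2-close to a payoff feasible for that [Q].  Continuity from above
    turns L2(P)-closeness into closeness in expectation, uniformly over [QQ],
    hence [g] is almost feasible for every [Q]. *)

(** * Minimax for finitely many functions *)

(** Mixing [u] again and again into the previous result multiplies the weight of [v] by [lam] each
    time. A single fixed [lam] thus yields the arbitrarily small steps that the descent below
    needs. *)
Lemma mix_pow (R : realFieldType) (G I : Type) (f : I -> G -> R) (lam : R) :
  0 <= lam ->
  (forall u v, exists z, forall i, (1 - lam) * f i u + lam * f i v <= f i z) ->
  forall k u v, exists z, forall i,
    (1 - lam ^+ k) * f i u + lam ^+ k * f i v <= f i z.
Proof.
move=> lam0 mix; elim=> [|k IH] u v.
  by exists v => i; rewrite expr0 subrr mul0r add0r mul1r.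
have [z hz] := IH u v; have [y hy] := mix u z; exists y => i.
apply: le_trans (hy i); have := ler_wpM2l lam0 (hz i); rewrite exprS; lra.
Qed.

Lemma concavelike_alternative (R : realType) (G : Type) (n : nat)
    (f : 'I_n -> G -> R) (lam B c : R) (g0 : G) :
  0 < lam < 1 -> (forall i g, `|f i g| <= B) ->
  (forall u v, exists z, forall i, (1 - lam) * f i u + lam * f i v <= f i z) ->
  (forall w : 'I_n -> R, (forall i, 0 <= w i) -> \sum_(i < n) w i = 1 ->
     exists g, c <= \sum_(i < n) w i * f i g) ->
  forall e, 0 < e -> exists g, forall i, c - e <= f i g.
Proof.
move=> /andP[lam0 lam1] fB mix hw e e0.
pose a i g := Num.max 0 (c - f i g).
have a0 i g : 0 <= a i g by rewrite /a le_max lexx.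
have ac i g : c - f i g <= a i g by rewrite /a le_max lexx orbT.
(* Descent: near a minimizer [u] of [phi], moving by a small weight [t = lam ^+ k]
   towards a best reply [v] to the normalized shortfalls decreases [phi] by
   about [2 t (inf phi)]. *)
pose phi g := \sum_(i < n) a i g ^+ 2.
have phi0 g : 0 <= phi g by apply: sumr_ge0 => i _; exact: sqr_ge0.
(* A value of [phi] below [e ^+ 2] bounds every shortfall by [e]. Otherwise [inf phi] is positive,
   which the descent refutes. *)
have [[g hg]|Hphi] := pselect (exists g, phi g < e ^+ 2).
  exists g => i; have : a i g ^+ 2 < e ^+ 2.
    apply: le_lt_trans hg; rewrite /phi (bigD1 i)//= lerDl.
    by apply: sumr_ge0 => j _; exact: sqr_ge0.
  by rewrite ltr_sqr ?nnegrE// ?(ltW e0)// => h; have := ac i g; lra.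
have phie g : e ^+ 2 <= phi g.
  by rewrite leNgt; apply/negP => h; apply: Hphi; exists g.
pose K := n%:R * (`|c| + B) ^+ 2.
have K0 : 0 <= K by rewrite mulr_ge0// sqr_ge0.
have cfB i g : (c - f i g) ^+ 2 <= (`|c| + B) ^+ 2.
  rewrite -(real_normK (num_real _)) lerXn2r ?nnegrE//.
    by rewrite addr_ge0// (le_trans _ (fB i g)).
  by rewrite (le_trans (ler_normB _ _))// lerD2l.
have sumK g : \sum_(i < n) (c - f i g) ^+ 2 <= K.
  rewrite /K -[n in n%:R]card_ord -sum1_card natr_sum mulr_suml ler_sum// => i _.
  by rewrite mul1r.
have phiK g : phi g <= K.
  apply: le_trans (sumK g); apply: ler_sum => i _; rewrite /a.
  by case: (leP 0 (c - f i g)) => // _; rewrite expr0n sqr_ge0.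
pose S : set R := range phi.
have Slb : has_lbound S by exists 0 => _ [g _ <-].
have S0 : S !=set0 by exists (phi g0); exists g0.
have e20 : 0 < e ^+ 2 by rewrite exprn_gt0.
have m0 : e ^+ 2 <= inf S by apply: lb_le_inf => // _ [g _ <-].
(* With [t = lam ^+ k], the second-order terms of the descent add up to at most [2 t^2 K], hence to
   at most [t * inf S]. The [+ 1] keeps the divisor positive when [K = 0]. *)
have [k hk] : exists k, lam ^+ k * (K + 1) <= inf S / 2.
  have /cvgrPdist_lt : (lam ^+ k @[k --> \oo] --> (0 : R)).
    by apply: cvg_expr; rewrite ger0_norm// ltW.
  have d0 : 0 < inf S / 2 / (K + 1).
    by rewrite divr_gt0// ?divr_gt0//; [exact: lt_le_trans m0|rewrite ltr_wpDl].
  move=> /(_ _ d0)[N _ /(_ N (leqnn N))] /=.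
  rewrite sub0r normrN ger0_norm ?exprn_ge0 ?(ltW lam0)// => h; exists N.
  by rewrite -ler_pdivlMr ?(ltW h)//; rewrite ltr_wpDl.
set t := lam ^+ k in hk.
have t0 : 0 < t by rewrite exprn_gt0.
have t1 : t <= 1 by rewrite exprn_ile1 ?ltW.
(* The tolerance [t * inf S] is half of the first-order gain [2 t * inf S]; the other half pays for
   the second-order terms. *)
have [_ [u _ <-] hu] : exists2 x, S x & x < inf S + t * inf S.
  by apply: inf_adherent => //; rewrite mulr_gt0// (lt_le_trans e20).
pose s := \sum_(i < n) a i u.
have s0 : 0 < s.
  rewrite lt_neqAle sumr_ge0 ?andbT//; apply/eqP => /esym/eqP.
  rewrite psumr_eq0// => /allP hs; have := phie u; rewrite /phi big1 => [|i _].
    by rewrite leNgt e20.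
  by have /eqP -> := hs i (mem_index_enum _); rewrite expr0n.
have [||v hv] := hw (fun i => a i u / s).
- by move=> i; rewrite divr_ge0// ltW.
- by rewrite -mulr_suml mulfV// gt_eqF.
(* The cross term of the expanded square: it is nonpositive because [v] reaches [c] on average under
   the weights [a i u / s]. *)
have hb : \sum_(i < n) a i u * (c - f i v) <= 0.
  under eq_bigr do rewrite mulrBr.
  rewrite sumrB -mulr_suml -/s subr_le0 mulrC -ler_pdivlMr//.
  apply: le_trans hv _; rewrite mulr_suml le_eqVlt; apply/orP; left; apply/eqP.
  by apply: eq_bigr => i _; rewrite mulrAC.
have [z hz] := mix_pow (ltW lam0) mix k u v.
have : phi z <= (1 - t) ^+ 2 * phi u + t ^+ 2 * K.
  (* The shortfall of [v] enters with its sign, not as a positive part; only so does the cross term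
     become [hb]. *)
  apply: (@le_trans _ _ (\sum_(i < n) ((1 - t) ^+ 2 * a i u ^+ 2 +
      2 * t * (1 - t) * (a i u * (c - f i v)) + t ^+ 2 * (c - f i v) ^+ 2))).
    apply: ler_sum => i _.
    have -> : (1 - t) ^+ 2 * a i u ^+ 2 +
      2 * t * (1 - t) * (a i u * (c - f i v)) + t ^+ 2 * (c - f i v) ^+ 2 =
      ((1 - t) * a i u + t * (c - f i v)) ^+ 2 by ring.
    have h : c - f i z <= (1 - t) * a i u + t * (c - f i v).
      have t1' : 0 <= 1 - t by rewrite subr_ge0.
      by have := hz i; have := ler_wpM2l t1' (ac i u); rewrite -/t; lra.
    rewrite {1}/a; case: (leP 0 (c - f i z)) => [h0|_].
      by rewrite lerXn2r ?nnegrE// (le_trans h0).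
    by rewrite expr0n sqr_ge0.
  rewrite !big_split /= -!mulr_sumr -/(phi u) lerD//.
    by rewrite gerDl mulr_ge0_le0// !mulr_ge0// ?subr_ge0// ltW.
  by rewrite ler_wpM2l// sqr_ge0.
have : inf S <= phi z by apply: ge_inf => //; exists z.
have : inf S <= phi u by apply: ge_inf => //; exists u.
have := phiK u; have tt : t ^+ 2 = t * t by [].
move: (phi u) (phi z) (inf S) hu m0 hk => p q I hu m0 hk pK Ip Iq qb.
exfalso.
have h1 := ler_wpM2l (ltW t0) hk.
have h2 := ler_wpM2l (ltW t0) Ip.
have h3 : t * t * p <= t * t * K by rewrite ler_wpM2l// mulr_ge0// ltW.
have h4 : 0 < t * I by rewrite mulr_gt0// (lt_le_trans e20).
have h5 : (1 - t) ^+ 2 * p = p - 2 * (t * p) + t * t * p by ring.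
rewrite h5 tt in qb.
have h6 : t * (t * (K + 1)) = t * t * K + t * t by ring.
nra.
Qed.

(** [N] plays the role of a squared norm and [D] of a squared distance; the
    hypothesis relating them is the parallelogram inequality for the weights
    of [mix]. *)
Lemma uniform_near_feasible (R : realType) (I G : Type) (A : set I) (C : set G)
    (e : I -> G -> R) (N : G -> R) (D : G -> G -> R) (mix : G -> G -> G)
    (c kappa M : R) :
  0 < kappa ->
  (forall g, C g -> 0 <= N g <= M) ->
  (forall g h, C g -> C h -> C (mix g h)) ->
  (forall i g h, A i -> C g -> C h -> c <= e i g -> c <= e i h ->
     c <= e i (mix g h)) ->
  (forall g h m, C g -> C h -> N g <= m -> N h <= m ->
     N (mix g h) + kappa * D g h <= m) ->
  (forall n (s : 'I_n -> I), (forall i, A (s i)) ->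
     exists2 g, C g & forall i, c <= e (s i) g) ->
  forall eta, 0 < eta -> exists2 g, C g &
    forall i, A i -> exists h, [/\ C h, c <= e i h & D g h <= eta].
Proof.
move=> k0 NM Cmix emix par feas eta eta0.
(* [r] is good when [N] is at least [r] on the feasible set of finitely many
   indices; a finite set almost realizing [sup good] works for all [i]. *)
pose good := [set r : R | exists n (s : 'I_n -> I), (forall i, A (s i)) /\
  forall g, C g -> (forall i, c <= e (s i) g) -> r <= N g].
have good_sup : has_sup good.
  split; last first.
    exists M => r [n [s [As h]]]; have [g Cg hg] := feas n s As.
    by apply: le_trans (h g Cg hg) _; case/andP: (NM g Cg).
  have f0 : 'I_0 -> I by case.
  by exists 0, 0%N, f0; split=> [[]//|g Cg _]; case/andP: (NM g Cg).
(* One [eps] is lost in approaching [sup good], another in choosing near-minimizers; together they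
   make [kappa * eta]. *)
pose eps := kappa * eta / 2.
have eps0 : 0 < eps by rewrite divr_gt0// mulr_gt0.
have [r [n [s [As hr]]] rsup] := sup_adherent eps0 good_sup.
(* If every payoff feasible for [s'] had [N] above [sup good + eps], that number would itself be
   good. *)
have near k (s' : 'I_k -> I) : (forall i, A (s' i)) ->
    exists g, [/\ C g, forall i, c <= e (s' i) g & N g <= sup good + eps].
  move=> As'; apply: contrapT => H.
  have : good (sup good + eps).
    exists k, s'; split => // g Cg hg; rewrite leNgt; apply/negP => hN.
    by apply: H; exists g; split => //; exact: ltW.
  by move=> /(ub_le_sup good_sup.2); rewrite gerDl leNgt eps0.
have [g [Cg hg Ng]] := near n s As; exists g => // Q AQ.
(* The family [s] extended by [Q] at index 0; [h] is then feasible for [Q] and for all of [s], so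
   that the mixture with [g] is still feasible for [s]. *)
have [|h [Ch hh Nh]] := near n.+1 (fun i => oapp s Q (unlift ord0 i)).
  by move=> i; case: (unliftP ord0 i) => [j|] _ /=; [exact: As|exact: AQ].
exists h; split => //; first by have := hh ord0; rewrite unlift_none.
have hsh i : c <= e (s i) h by have := hh (lift ord0 i); rewrite liftK.
have := par _ _ _ Cg Ch Ng Nh.
have : r <= N (mix g h) by apply: hr => [|i]; [exact: Cmix|exact: emix].
move=> h1 h2; rewrite -(ler_pM2l k0); have -> : kappa * eta = eps + eps by rewrite /eps; lra.
lra.
Qed.

(** The series of the [f n] has integral at most 1, so it is finite almost everywhere; there each
    term lies below a vanishing tail. *)
Lemma ae_cvg0_summable d (T : measurableType d) (R : realType)
    (mu : {measure set T -> \bar R}) (f : nat -> T -> R) :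
  (forall n, measurable_fun setT (f n)) -> (forall n w, 0 <= f n w) ->
  (forall n, \int[mu]_w (f n w)%:E <= (1 / (2 ^ n.+1)%:R)%:E)%E ->
  {ae mu, forall w, f n w @[n --> \oo] --> (0 : R)}.
Proof.
move=> mf f0 If.
have mEf n : measurable_fun setT (fun w => (f n w)%:E) by exact/measurable_EFinP.
pose g w := (\sum_(0 <= n <oo) (f n w)%:E)%E.
have mg : measurable_fun setT g.
  by apply: ge0_emeasurable_sum => // n w _ _; rewrite lee_fin.
have g0 w : (0 <= g w)%E by apply: nneseries_ge0 => n _ _; rewrite lee_fin.
have ig : mu.-integrable setT g.
  apply/integrableP; split => //.
  under eq_integral do rewrite gee0_abs//.
  rewrite integral_nneseries//; last by move=> n w _; rewrite lee_fin.
  apply: (@le_lt_trans _ _ (\sum_(0 <= n <oo) (1 / (2 ^ n.+1)%:R)%:E)%E).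
    apply: lee_nneseries => // n _ _.
    by apply: integral_ge0 => w _; rewrite lee_fin.
  by apply: le_lt_trans (epsilon_trick0 _ ler01) _; rewrite ltry.
have := integrable_ae measurableT ig; apply: filterS => w /(_ I) gfin.
have fw0 k : (0 <= (f k w)%:E)%E by rewrite lee_fin.
have := @nneseries_tail_cvg _ (fun n => (f n w)%:E) xpredT.
rewrite -[X in (X < _)%E]/(g w) -ge0_fin_numE//.
move=> /(_ gfin (fun k _ => fw0 k)) /fine_cvgP[tfin tail].
apply: squeeze_cvgr (cvg_cst 0) tail.
apply: filterS tfin => n tn; rewrite f0/= -lee_fin fineK//.
rewrite (@nneseries_split _ _ n 1%N)// addn1 big_nat1 leeDl//.
by apply: nneseries_ge0.
Qed.

(** * Stopped payoffs *)

Section grid.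
Context {R : realType}.
Implicit Types (T t s : R) (n : nat).

(** Approximates [t] from above by multiples of [T / n.+1]; the maximum with 1
    keeps the stopping time [grid T n tau] from vanishing, as (A) requires. *)
Definition grid T n t : R :=
  T * (Num.max 1 (Num.ceil (t / T * n.+1%:R)))%:~R / n.+1%:R.

(** Turns the event that the rounded time is at most [s] into a threshold on [t] itself, at the last
    grid point not after [s]. The stopping property in [grid_stopping] rests on this. *)
Lemma grid_le_iff T n t s : 0 < T -> (grid T n t <= s) =
  (T / n.+1%:R <= s) && (t <= T * (Num.floor (s / T * n.+1%:R))%:~R / n.+1%:R).
Proof.
move=> T0; have n0 : 0 < n.+1%:R :> R by [].
have key (x y : R) : (T * x / n.+1%:R <= y) = (x <= y / T * n.+1%:R).
  by rewrite ler_pdivrMr// -ler_pdivlMl// mulrA [_^-1 * y]mulrC.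
have key' (x y : R) : (y <= T * x / n.+1%:R) = (y / T * n.+1%:R <= x).
  by rewrite ler_pdivlMr// -ler_pdivrMl// mulrA [_^-1 * y]mulrC.
rewrite /grid key -floor_ge_int ge_max floor_ge_int -key mulr1; congr (_ && _).
by rewrite key' ceil_le_int.
Qed.

Lemma grid_ge T n t : 0 < T -> t <= grid T n t.
Proof.
move=> T0; have := lexx (grid T n t); rewrite {1}grid_le_iff// => /andP[_].
move=> /le_trans; apply.
rewrite ler_pdivrMr// -ler_pdivlMl// mulrA [_^-1 * _]mulrC.
exact: floor_le.
Qed.

Lemma grid_gt0 T n t : 0 < T -> 0 < grid T n t.
Proof.
move=> T0; have := lexx (grid T n t); rewrite {1}grid_le_iff// => /andP[+ _].
by apply: lt_le_trans; rewrite divr_gt0.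
Qed.

Lemma grid_leD T n t : 0 < T -> 0 <= t -> grid T n t <= t + T / n.+1%:R.
Proof.
move=> T0 t0; rewrite /grid maxEle; case: ifPn => _; last first.
  by rewrite mulr1 lerDr.
have n0 : 0 < n.+1%:R :> R by [].
set x := t / T * n.+1%:R.
have -> : t + T / n.+1%:R = T * (x + 1) / n.+1%:R.
  by rewrite /x; field; rewrite !gt_eqF// addrC natr1.
rewrite ler_pM2r ?invr_gt0// ler_pM2l//.
have /andP[+ _] := ceil_itv x; rewrite intrB => h; lra.
Qed.

Lemma grid_le T n t : 0 < T -> t <= T -> grid T n t <= T.
Proof.
move=> T0 tT; have n0 : 0 < n.+1%:R :> R by [].
rewrite grid_le_iff// divff ?gt_eqF// mul1r; apply/andP; split.
  by rewrite ler_pdivrMr// ler_peMr ?(ltW T0)// ler1n.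
have -> : Num.floor (n.+1%:R : R) = n.+1%:Z by apply: (@intrKfloor R n.+1%:Z).
by rewrite mulfK// gt_eqF.
Qed.

Lemma grid_nat T n t : 0 < T -> t <= T ->
  exists2 k, (k <= n.+1)%N & grid T n t = T * k%:R / n.+1%:R.
Proof.
move=> T0 tT; have n0 : 0 < n.+1%:R :> R by [].
have := grid_le n T0 tT; rewrite /grid.
rewrite ler_pdivrMr// ler_pM2l//.
have : (0 <= Num.max 1%Z (Num.ceil (t / T * n.+1%:R)))%R by rewrite le_max.
case: (Num.max _ _) => // k _; rewrite -[n.+1%:R]/(n.+1%:Z%:~R) ler_int => hk.
by exists k.
Qed.

Lemma grid_cvg T t : 0 < T -> 0 <= t -> grid T n t @[n --> \oo] --> t.
Proof.
move=> T0 t0; apply: (@squeeze_cvgr _ _ _ _ (fun=> t)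
    (fun n => t + T * (n.+1%:R)^-1)).
- by near=> n; rewrite grid_ge//= grid_leD.
- exact: cvg_cst.
- rewrite -[X in _ --> X]addr0; apply: cvgD; first exact: cvg_cst.
  rewrite -[X in _ --> X](mulr0 T); apply: cvgMl_tmp; exact: cvg_harmonic.
Unshelve. all: by end_near. Qed.

End grid.

Section sigma_algebra.
Context {U : pointedType} (G : set (set U)) (sG : sigma_algebra setT G).

Lemma sigma_algebraU A B : G A -> G B -> G (A `|` B).
Proof.
rewrite -(measurable_g_measurableTypeE sG).
exact: (@measurableU _ (g_sigma_algebraType G)).
Qed.

Lemma sigma_algebraI A B : G A -> G B -> G (A `&` B).
Proof.
rewrite -(measurable_g_measurableTypeE sG).
exact: (@measurableI _ (g_sigma_algebraType G)).
Qed.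

Lemma sigma_algebraD A B : G A -> G B -> G (A `\` B).
Proof.
rewrite -(measurable_g_measurableTypeE sG).
exact: (@measurableD _ (g_sigma_algebraType G)).
Qed.
End sigma_algebra.

(** * Measurability of the process, discretization and pasting of stopping times *)

Section process.
Context {d : measure_display} {Omega : measurableType d} {R : realType}.
Context (T : R) (F : R -> set (set Omega)) (Y : R -> Omega -> R).
Context (T0 : 0 < T) (filtF : filtration T F).
Context (adY : forall t, 0 <= t <= T ->
  forall B, measurable B -> F t (Y t @^-1` B)).
Context (rcY : forall w t, 0 <= t < T -> Y ^~ w x @[x --> t^'+] --> Y t w).
Context (bdY : forall w, exists M : R, forall t, 0 <= t <= T -> `|Y t w| <= M).

Lemma filtration_measurable t A : 0 <= t <= T -> F t A -> measurable A.
Proof. by move=> ht; exact: filtF.2.1. Qed.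

Lemma grid_itv n t : 0 <= t <= T -> 0 <= grid T n t <= T.
Proof. by move=> /andP[t0 tT]; rewrite ltW ?grid_gt0//= grid_le. Qed.

Lemma path_grid_cvg w t : 0 <= t <= T ->
  Y (grid T n t) w @[n --> \oo] --> Y t w.
Proof.
(* At [t = T] right-continuity says nothing, but there the grid value is always [T]. *)
move=> /andP[t0]; rewrite le_eqVlt => /predU1P[->|tT].
  rewrite (_ : (fun n => _) = cst (Y T w)); first exact: cvg_cst.
  apply/funext => n /=; congr (Y _ w).
  by apply/eqP; rewrite eq_le grid_ge// grid_le.
have := @rcY w t; rewrite t0 tT => /(_ isT) /cvgrPdist_lt rc.
apply/cvgrPdist_lt => e e0; have [r /= r0 hr] := rc e e0.
have /cvgrPdist_lt/(_ r r0) := grid_cvg T0 t0.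
apply: filterS => n /= hn; have := grid_ge n t T0.
(* The filter [t^'+] excludes [t], so a grid value equal to [t] is treated apart. *)
rewrite le_eqVlt => /predU1P[<-|tn]; first by rewrite subrr normr0.
exact: hr.
Qed.

Lemma Ystar_ge w t : 0 <= t <= T -> `|Y t w| <= Ystar T Y w.
Proof.
move=> ht; have [M hM] := bdY w; apply: ub_le_sup; last first.
  by exists t; rewrite //= in_itv.
by exists M => _ [s /= + <-]; rewrite in_itv; exact: hM.
Qed.

Lemma Ystar_le w a : (forall t, 0 <= t <= T -> `|Y t w| <= a) -> Ystar T Y w <= a.
Proof.
move=> h; apply: ge_sup.
  by exists `|Y 0 w|, 0; rewrite //= in_itv/= lexx ltW.
by move=> _ [s /= + <-]; rewrite in_itv; exact: h.
Qed.

Lemma Ystar_ge0 w : 0 <= Ystar T Y w.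
Proof.
by apply: le_trans (normr_ge0 (Y 0 w)) _; apply: Ystar_ge; rewrite lexx ltW.
Qed.

Lemma measurable_adapted t : 0 <= t <= T -> measurable_fun setT (Y t).
Proof.
move=> ht _ B mB; rewrite setTI; apply: (filtration_measurable ht); exact: adY.
Qed.

(** By [path_grid_cvg], a path whose absolute value exceeds [r] somewhere does so at some point
    [T * k / n.+1], so the uncountable supremum reduces to countably many times. *)
Lemma measurable_Ystar : measurable_fun setT (Ystar T Y).
Proof.
apply: (measurability _ (RGenOInfty.measurableE R)) => _ [_ [r ->] <-].
rewrite setTI (_ : _ @^-1` _ = \bigcup_n \bigcup_(k in `I_n.+2)
    (Y (T * k%:R / n.+1%:R) @^-1` [set y | r < `|y|])); last first.
  apply/seteqP; split => w /=; rewrite in_itv/= andbT.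
    move=> hr; have [t ht tr] : exists2 t, 0 <= t <= T & r < `|Y t w|.
      apply: contrapT => H; move: hr; rewrite ltNge => /negP; apply.
      apply: Ystar_le => t ht; rewrite leNgt; apply/negP => h; apply: H.
      by exists t.
    have [n _ hn] := cvgr_gt _ (cvg_norm (@path_grid_cvg w t ht)) _ tr.
    exists n => //; have [k kn hk] := grid_nat n T0 (elimT andP ht).2.
    by exists k => //=; rewrite -hk; exact: hn n (leqnn n).
  move=> [n _ [k /= kn hr]]; apply: lt_le_trans hr _; apply: Ystar_ge.
  by rewrite !mulr_ge0 ?(ltW T0)//= ler_pdivrMr// ler_pM2l// ler_nat -ltnS.
apply: bigcup_measurable => n _; apply: fin_bigcup_measurable => // k /= kn.
have ht : 0 <= T * k%:R / n.+1%:R <= T.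
  by rewrite !mulr_ge0 ?(ltW T0)//= ler_pdivrMr// ler_pM2l// ler_nat -ltnS.
rewrite -[X in measurable X]setTI; apply: measurable_adapted => //.
rewrite (_ : [set _ | _] = Num.norm @^-1` `]r, +oo[).
  rewrite -[X in measurable X]setTI; exact: normr_measurable.
by apply/seteqP; split => y /=; rewrite in_itv/= andbT.
Qed.

Lemma measurable_finite_stopped tau :
  finite_stopping_time T F tau -> measurable_fun setT (stopped Y tau).
Proof.
move=> [[tauT tauF] fin] _ B mB; rewrite setTI.
have mle t : 0 <= t <= T -> measurable [set w | tau w <= t].
  by move=> ht; apply: (filtration_measurable ht); exact: tauF.
have mtau : measurable_fun setT tau.
  apply: (measurability _ (RGenOInfty.measurableE R)) => _ [_ [r ->] <-].
  rewrite setTI (_ : _ @^-1` _ = ~` [set w | tau w <= r]); last first.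
    by apply/seteqP; split => w /=; rewrite in_itv/= andbT ltNge => /negP.
  apply: measurableC.
  (* The filtration is controlled on [[0, T]] only; for other [r] the event is empty or
     everything. *)
  have [r0|r0] := ltP r 0.
    rewrite (_ : [set _ | _] = set0)// -subset0 => w /= h.
    by have /andP[h0 _] := tauT w; move: r0; rewrite ltNge (le_trans h0 h).
  have [rT|rT] := leP r T; first by apply: mle; rewrite r0.
  rewrite (_ : [set _ | _] = setT)//; apply/seteqP; split => // w _ /=.
  by rewrite (le_trans _ (ltW rT))//; case/andP: (tauT w).
rewrite (_ : _ @^-1` _ = \bigcup_(t in range tau)
    ((tau @^-1` [set t]) `&` (Y t @^-1` B))).
  apply: fin_bigcup_measurable => // _ [w _ <-]; apply: measurableI.
    by rewrite -[X in measurable X]setTI; exact: mtau.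
  by rewrite -[X in measurable X]setTI; exact: measurable_adapted.
apply/seteqP; split => w /=; first by move=> h; exists (tau w).
by move=> [t _ [<- h]].
Qed.

Lemma grid_stopping n tau : stopping_time T F tau ->
  finite_stopping_time T F (fun w => grid T n (tau w)).
Proof.
move=> [tauT tauF]; split; first split.
- by move=> w; exact: grid_itv.
- move=> t /andP[t0 tT].
  have ht : 0 <= t <= T by rewrite t0.
  have F0 : F t set0 by have [] := filtF.1 t ht.
  have [h|h] := leP (T / n.+1%:R) t; last first.
    rewrite (_ : [set _ | _] = set0)// -subset0 => w /=.
    by rewrite grid_le_iff// leNgt h.
  (* The last grid point not after [t]: the event equals [tau <= s], which lies in [F s] and hence
     in [F t]. *)
  set s := T * (Num.floor (t / T * n.+1%:R))%:~R / n.+1%:R.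
  have st : s <= t.
    rewrite /s ler_pdivrMr// -ler_pdivlMl// mulrA [_^-1 * _]mulrC.
    exact: floor_le.
  have s0 : 0 <= s.
    rewrite !mulr_ge0 ?invr_ge0 ?(ltW T0)// ler0z floor_ge0.
    by rewrite !mulr_ge0 ?invr_ge0 ?(ltW T0).
  apply: (filtF.2.2 s t s0 st tT).
  rewrite (_ : [set _ | _] = [set w | tau w <= s]).
    by apply: tauF; rewrite s0 (le_trans st).
  by apply/seteqP; split => w /=; rewrite grid_le_iff// h.
- apply: (@sub_finite_set _ _ ((fun k : nat => T * k%:R / n.+1%:R) @` `I_n.+2)).
    move=> _ [w _ <-] /=; have [k kn ->] := grid_nat n T0 (elimT andP (tauT w)).2.
    by exists k.
  exact: finite_image.
Qed.

Lemma stopped_grid_cvg tau w : stopping_time T F tau ->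
  stopped Y (fun w => grid T n (tau w)) w @[n --> \oo] --> stopped Y tau w.
Proof. by move=> [tauT _]; exact: path_grid_cvg. Qed.

Lemma measurable_stopped tau :
  stopping_time T F tau -> measurable_fun setT (stopped Y tau).
Proof.
move=> st; apply: (@measurable_fun_cvg _ _ _ _
    (fun n => stopped Y (fun w => grid T n (tau w)))).
  by move=> n; apply: measurable_finite_stopped; exact: grid_stopping.
by move=> w _; exact: stopped_grid_cvg.
Qed.

Lemma stopped_le tau w : stopping_time T F tau -> `|stopped Y tau w| <= Ystar T Y w.
Proof. by move=> [tauT _]; exact: Ystar_ge. Qed.

(** Either time being at most [t] forces the minimum to be at most [t]. Up to [t], [A] may therefore
    be replaced by its trace on that event, which is in [F t]. *)
Lemma paste_stopping tau1 tau2 A : stopping_time T F tau1 ->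
  stopping_time T F tau2 ->
  stopped_sigma T F (fun w => Order.min (tau1 w) (tau2 w)) A ->
  stopping_time T F (fun w => if w \in A then tau2 w else tau1 w).
Proof.
move=> [tT1 tF1] [tT2 tF2] [_ AF]; split; first by move=> w; case: ifP.
move=> t ht; have := AF t ht; set m := [set w | _ <= t] => Am.
have sF := filtF.1 t ht.
rewrite (_ : [set _ | _] = ((A `&` m) `&` [set w | tau2 w <= t]) `|`
   ([set w | tau1 w <= t] `\` (A `&` m))).
  apply: (sigma_algebraU sF).
    by apply: (sigma_algebraI sF) => //; exact: tF2.
  by apply: (sigma_algebraD sF) => //; exact: tF1.
apply/seteqP; split => w /=; rewrite /m /= ge_min.
  case: ifPn => [/set_mem wA h|/negP wA h]; [left|right]; split => //.
    by split => //; rewrite h orbT.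
  by case=> /mem_set.
case: ifPn => [/set_mem wA [[_ //]|[h k]]|/negP wA [[[/mem_set //]]|[]//]].
by exfalso; apply: k; rewrite h.
Qed.
End process.

(** * Uniform integrability over the set of measures *)

Section robust.
Context {d : measure_display} {Omega : measurableType d} {R : realType}.
Context (P : probability Omega R) (T : R) (Y : R -> Omega -> R).
Context (QQ : set (probability Omega R)).
Context (mYs : measurable_fun setT (Ystar T Y)) (Ys0 : forall w, 0 <= Ystar T Y w).
Context (L1Y : in_L1 QQ (Ystar T Y)) (cfa : cont_from_above_at0 P T Y QQ).

(** A form of [Xset] with an explicit constant and a bound at every point, so that it can be
    integrated under each [Q] without discussing null sets. *)
Definition dominated (K : R) : set (Omega -> R) :=
  [set X : Omega -> R | measurable_fun setT X /\ forall w, `|X w| <= K * (Ystar T Y w + 1)].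

Lemma dominated_integrable K X Q : QQ Q -> dominated K X ->
  Q.-integrable setT (EFin \o X).
Proof.
move=> QQQ [mX bX].
have iYs : Q.-integrable setT (EFin \o Ystar T Y).
  apply/integrableP; split; first exact/measurable_EFinP.
  by apply: le_lt_trans L1Y; apply: ereal_sup_ubound; exists Q.
have i1 : Q.-integrable setT (EFin \o cst (1 : R)).
  exact: finite_measure_integrable_cst.
have := integrableZl measurableT K (integrableD measurableT iYs i1).
apply: le_integrable => //; first exact/measurable_EFinP.
by move=> w _ /=; rewrite lee_fin (le_trans (bX w))// ler_norm.
Qed.

Lemma dominated_EFin K X Q : QQ Q -> dominated K X ->
  (\int[Q]_w (X w)%:E)%E = (\int[Q]_w X w)%:E.
Proof.
move=> QQQ dX; rewrite /Rintegral fineK//.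
exact: integrable_fin_num (dominated_integrable QQQ dX).
Qed.

Lemma dominated_norm K X : dominated K X -> dominated K (fun w => `|X w|).
Proof.
move=> [mX bX]; split; first exact: measurableT_comp.
by move=> w; rewrite normr_id.
Qed.

Lemma dominated_scale K X r : dominated K X ->
  dominated (`|r| * K) (fun w => r * X w).
Proof.
move=> [mX bX]; split; first exact: measurable_funM.
by move=> w; rewrite normrM -mulrA ler_wpM2l.
Qed.

Lemma dominatedD K L X Z : dominated K X -> dominated L Z ->
  dominated (K + L) (fun w => X w + Z w).
Proof.
move=> [mX bX] [mZ bZ]; split; first exact: measurable_funD.
by move=> w; rewrite mulrDl (le_trans (ler_normD _ _))// lerD.
Qed.

Lemma dominatedB K L X Z : dominated K X -> dominated L Z ->
  dominated (K + L) (fun w => X w - Z w).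
Proof.
move=> [mX bX] [mZ bZ]; split; first exact: measurable_funB.
by move=> w; rewrite mulrDl (le_trans (ler_normB _ _))// lerD.
Qed.

(** Dominated convergence uniformly over [QQ]. The suprema [V n] of the tails of [|X n|] decrease to
    0, so continuity from above applies to them, and [rhoQ] of [V n] bounds all the integrals at
    once. *)
Lemma robust_dominated_cvg K (X : nat -> Omega -> R) :
  (forall n, dominated K (X n)) ->
  {ae P, forall w, X n w @[n --> \oo] --> (0 : R)} ->
  forall delta, 0 < delta ->
  exists n, forall Q, QQ Q -> \int[Q]_w `|X n w| <= delta.
Proof.
move=> dX X0 delta delta0.
have ubX w : has_ubound (range (fun n => `|X n w|)).
  by exists (K * (Ystar T Y w + 1)) => _ [n _ <-]; exact: (dX n).2.
have ubS w n : has_ubound (sdrop (fun n => `|X n w|) n).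
  by have [M hM] := ubX w; exists M => _ [m _ <-]; apply: hM; exists m.
pose V n w := sups (fun n => `|X n w|) n.
have XV n w : `|X n w| <= V n w.
  by apply: ub_le_sup => //; exists n => /=.
have VK n w : `|V n w| <= K * (Ystar T Y w + 1).
  rewrite ger0_norm ?(le_trans _ (XV n w))//; apply: ge_sup.
    by exists `|X n w|, n => /=.
  by move=> _ [m _ <-]; exact: (dX m).2.
have dV n : dominated K (V n).
  split => //; apply: measurable_fun_sups => [w _|m]; first exact: ubX.
  exact: (dominated_norm (dX m)).1.
have [||_ cv] := @cfa V.
- move=> n; split; first exact: (dV n).1.
  (* [Xset] requires a positive constant, and no sign of [K] is given. *)
  exists (`|K| + 1); split; first by rewrite ltr_wpDl.
  apply: aeW => w; rewrite (le_trans (VK n w))//.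
  rewrite ler_wpM2r ?addr_ge0// (le_trans (ler_norm K))// lerDl//.
- apply: filterS X0 => w hw; split=> [n|].
    exact: (nonincreasing_sups (ubX w)) (leqnSn n).
  by apply: cvg_sups; rewrite -(@normr0 _ R); exact: cvg_norm.
move: cv => /fine_cvgP[fin /cvgrPdist_lt/(_ _ delta0) near0].
have [n _ /(_ n (leqnn n))[finn hn]] := filterI fin near0.
exists n => Q QQQ.
apply: (@le_trans _ _ (\int[Q]_w V n w)).
  apply: le_Rintegral => //.
  - exact: dominated_integrable QQQ (dominated_norm (dX n)).
  - exact: dominated_integrable QQQ (dV n).
rewrite -lee_fin -(dominated_EFin QQQ (dV n)).
apply: (@le_trans _ _ (rhoQ QQ (V n))); first by apply: ereal_sup_ubound; exists Q.
rewrite -(fineK finn) lee_fin; move: hn; rewrite /= sub0r normrN => hn.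
exact: le_trans (ler_norm _) (ltW hn).
Qed.

(* Since [1 + y <= expR y], this weight makes all dominated variables bounded. *)
Definition weight w : R := expR (- Ystar T Y w).

(** The squared norm of [X] in L2 of the measure with density [weight ^+ 2] with respect to [P]. *)
Definition energy (X : Omega -> R) : R := \int[P]_w (X w * weight w) ^+ 2.

Lemma dominated_weight K X w : dominated K X -> `|X w * weight w| <= K.
Proof.
move=> [_ bX]; rewrite normrM (ger0_norm (expR_ge0 _)).
rewrite /weight expRN ler_pdivrMr ?expR_gt0//.
apply: le_trans (bX w) _.
have K0 : 0 <= K.
  have := le_trans (normr_ge0 _) (bX w).
  by rewrite pmulr_lge0// ltr_wpDl.
by rewrite ler_wpM2l// addrC expR_ge1Dx.
Qed.

Lemma measurable_weighted K X : dominated K X ->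
  measurable_fun setT (fun w => X w * weight w).
Proof.
move=> [mX _]; apply: measurable_funM => //.
by apply: measurableT_comp; [exact: measurable_expR|exact: measurableT_comp].
Qed.

Lemma weighted2_integrable K L X Z : dominated K X -> dominated L Z ->
  P.-integrable setT (EFin \o (fun w => (X w * weight w) * (Z w * weight w))).
Proof.
move=> dX dZ; apply: measurable_bounded_integrable => //.
- by rewrite (le_lt_trans (probability_le1 _ _))// ltry.
- by apply: measurable_funM; [exact: measurable_weighted dX|exact: measurable_weighted dZ].
- exists (K * L); split; first exact: num_real.
  move=> M KM w _ /=; apply: le_trans (ltW KM).
  by rewrite normrM ler_pM//; [exact: dominated_weight|exact: dominated_weight].
Qed.

Lemma energy_EFin K X : dominated K X ->
  (\int[P]_w ((X w * weight w) ^+ 2)%:E)%E = (energy X)%:E.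
Proof.
move=> dX; rewrite /energy /Rintegral fineK//.
exact: integrable_fin_num (weighted2_integrable dX dX).
Qed.

Lemma energy_ge0 X : 0 <= energy X.
Proof. by apply: Rintegral_ge0 => w _; exact: sqr_ge0. Qed.

Lemma energy_le K X : dominated K X -> energy X <= K ^+ 2.
Proof.
move=> dX; have -> : K ^+ 2 = \int[P]_w (cst (K ^+ 2) w).
  rewrite Rintegral_cst// -[LHS]mulr1; congr (_ * _).
  by exact: (esym (congr1 fine (probability_setT P))).
apply: le_Rintegral => //; first exact: (weighted2_integrable dX dX).
  exact: finite_measure_integrable_cst.
move=> w _ /=; rewrite -(real_normK (num_real _)) lerXn2r ?nnegrE//.
  exact: le_trans (normr_ge0 _) (dominated_weight w dX).
exact: dominated_weight.
Qed.

(** The parallelogram identity for unequal weights, from expanding both squares: the mixed integrals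
    cancel. It supplies [kappa = (1 - lam) * lam] in [uniform_near_feasible]. *)
Lemma energy_mix K X Z lam : dominated K X -> dominated K Z ->
  energy (fun w => (1 - lam) * X w + lam * Z w) +
    (1 - lam) * lam * energy (fun w => X w - Z w) =
  (1 - lam) * energy X + lam * energy Z.
Proof.
move=> dX dZ; have iXX := weighted2_integrable dX dX.
have iZZ := weighted2_integrable dZ dZ; have iXZ := weighted2_integrable dX dZ.
have iZl a f : P.-integrable setT (EFin \o f) ->
    P.-integrable setT (EFin \o (fun w => a * f w)).
  by move=> h; exact: (integrableZl measurableT a h).
have lin a b c :
    \int[P]_w (a * (X w * weight w * (X w * weight w)) +
      (b * (X w * weight w * (Z w * weight w)) +
       c * (Z w * weight w * (Z w * weight w)))) =
    a * energy X + (b * (\int[P]_w (X w * weight w * (Z w * weight w))) +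
      c * energy Z).
  rewrite RintegralD//; [|exact: iZl|].
    rewrite RintegralD//; [|exact: iZl|exact: iZl].
    by rewrite !RintegralZl.
  exact: (integrableD measurableT (iZl b _ iXZ) (iZl c _ iZZ)).
have -> : energy (fun w => (1 - lam) * X w + lam * Z w) =
  (1 - lam) ^+ 2 * energy X + (2 * (1 - lam) * lam *
    (\int[P]_w (X w * weight w * (Z w * weight w))) + lam ^+ 2 * energy Z).
  by rewrite -lin; apply: eq_Rintegral => w _; ring.
have -> : energy (fun w => X w - Z w) =
  1 * energy X + (- 2 * (\int[P]_w (X w * weight w * (Z w * weight w))) +
    1 * energy Z).
  by rewrite -lin; apply: eq_Rintegral => w _; ring.
ring.
Qed.

(** By contradiction: counterexamples with energies at most [1 / 2 ^ n.+1] converge to 0 [P]-almost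
    surely, and [robust_dominated_cvg] then makes one of their integrals small. *)
Lemma robust_small_energy K delta : 0 < delta -> exists2 eta, 0 < eta &
  forall X, dominated K X -> energy X <= eta ->
    forall Q, QQ Q -> \int[Q]_w `|X w| <= delta.
Proof.
move=> delta0; apply: contrapT => H.
have /choice[X hX] : forall n : nat, exists X, [/\ dominated K X,
    energy X <= 1 / (2 ^ n.+1)%:R & exists2 Q, QQ Q & delta < \int[Q]_w `|X w|].
  move=> n; apply: contrapT => H'; apply: H.
  exists (1 / (2 ^ n.+1)%:R); first by rewrite divr_gt0// ltr0n expn_gt0.
  move=> X dX eX Q QQQ; rewrite leNgt; apply/negP => h; apply: H'.
  by exists X; split => //; exists Q.
have dX n : dominated K (X n) by have [] := hX n.
have ae0 : {ae P, forall w, X n w @[n --> \oo] --> (0 : R)}.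
  have := @ae_cvg0_summable _ _ _ P (fun n w => (X n w * weight w) ^+ 2).
  have h1 n : measurable_fun setT (fun w => (X n w * weight w) ^+ 2).
    by apply: measurable_funX; exact: measurable_weighted (dX n).
  have h2 n w : 0 <= (X n w * weight w) ^+ 2 by exact: sqr_ge0.
  have h3 n : (\int[P]_w ((X n w * weight w) ^+ 2)%:E <= (1 / (2 ^ n.+1)%:R)%:E)%E.
    by rewrite (energy_EFin (dX n)) lee_fin; have [] := hX n.
  move=> /(_ h1 h2 h3); apply: filterS => w /cvgrPdist_lt hw.
  apply/cvgrPdist_lt => e e0.
  have W0 : 0 < weight w by exact: expR_gt0.
  (* At a fixed [w] the weight is a positive constant, which cancels after taking roots. *)
  have := hw ((e * weight w) ^+ 2) _; rewrite exprn_gt0 ?mulr_gt0// => /(_ isT).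
  apply: filterS => n; rewrite !sub0r !normrN (ger0_norm (sqr_ge0 _)).
  rewrite -(real_normK (num_real (X n w * _))) ltr_sqr ?nnegrE//.
    by rewrite normrM (gtr0_norm W0) ltr_pM2r.
  by rewrite mulr_ge0// ltW.
have [n hn] := robust_dominated_cvg dX ae0 delta0.
by have [_ _ [Q QQQ]] := hX n; rewrite ltNge hn.
Qed.
End robust.

(** * Finite mixtures of measures *)

Section mixture.
Context {d : measure_display} {U : measurableType d} {R : realType}.
Context (n : nat) (w : 'I_n -> R) (Qs : 'I_n -> probability U R).
Context (w0 : forall i, 0 <= w i).

(** [msum] takes a family indexed by [nat], so the one indexed by ['I_n] is padded with the zero
    measure. *)
Let part (k : nat) : measure U R :=
  if insub k is Some i then mscale (NngNum (w0 i)) (Qs i) else mzero.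

Let partE (i : 'I_n) : part i = mscale (NngNum (w0 i)) (Qs i).
Proof. by rewrite /part valK. Qed.

Let mix_measure : measure U R := msum part n.

Let mix_measureE A : mix_measure A = (\sum_(i < n) (w i)%:E * Qs i A)%E.
Proof. by apply: eq_bigr => i _; rewrite partE. Qed.

Lemma mixture_exists : \sum_(i < n) w i = 1 ->
  exists mu : probability U R, forall A, mu A = (\sum_(i < n) (w i)%:E * Qs i A)%E.
Proof.
move=> w1; have m1 : mix_measure setT = 1%E.
  rewrite mix_measureE; under eq_bigr do rewrite probability_setT mule1.
  by rewrite sumEFin w1.
(* The total mass is 1 already; normalizing changes no value and only supplies the structure of a
   probability. *)
exists (mnormalize mix_measure (dirac point)) => A.
by rewrite -mix_measureE /= /mnormalize m1 onee_eq0/= invr1 mule1.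
Qed.

Section integral.
Context (mu : probability U R).
Context (muE : forall A, measurable A ->
  mu A = (\sum_(i < n) (w i)%:E * Qs i A)%E).

Let ge0_integral_mixture (g : U -> \bar R) :
  measurable_fun setT g -> (forall x, 0 <= g x)%E ->
  (\int[mu]_x g x = \sum_(i < n) (w i)%:E * \int[Qs i]_x g x)%E.
Proof.
move=> mg g0; rewrite (eq_measure_integral mix_measure); last first.
  by move=> A mA _; rewrite mix_measureE; exact: muE.
rewrite ge0_integral_measure_sum//; apply: eq_bigr => i _.
by rewrite partE ge0_integral_mscale.
Qed.

Lemma integral_mixture (f : U -> R) :
  (forall i, (Qs i).-integrable setT (EFin \o f)) ->
  measurable_fun setT f ->
  (\int[mu]_x (f x)%:E = (\sum_(i < n) w i * \int[Qs i]_x f x)%:E)%E.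
Proof.
move=> fi mf; have mEf : measurable_fun setT (EFin \o f) by exact/measurable_EFinP.
rewrite integralE !ge0_integral_mixture//; last 2 first.
- exact: measurable_funeneg.
- exact: measurable_funepos.
have Ep i := integrable_fin_num measurableT (integrable_funepos measurableT (fi i)).
have En i := integrable_fin_num measurableT (integrable_funeneg measurableT (fi i)).
under eq_bigr do rewrite -(fineK (Ep _)) -EFinM.
under [X in (_ - X)%E]eq_bigr do rewrite -(fineK (En _)) -EFinM.
rewrite !sumEFin -EFinB -sumrB; congr (_%:E); apply: eq_bigr => i _.
by rewrite -mulrBr -fineB//; congr (_ * fine _); rewrite [RHS]integralE.
Qed.
End integral.
End mixture.

(** * Attainable payoffs *)

Section minimax.
Context {d : measure_display} {Omega : measurableType d} {R : realType}.
Context (T : R) (P : probability Omega R) (F : R -> set (set Omega)).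
Context (QQ : set (probability Omega R)) (Y : R -> Omega -> R).
Context (T0 : 0 < T) (filtF : filtration T F).
Context (adY : forall t, 0 <= t <= T ->
  forall B, measurable B -> F t (Y t @^-1` B)).
Context (rcY : forall w t, 0 <= t < T -> Y ^~ w x @[x --> t^'+] --> Y t w).
Context (bdY : forall w, exists M : R, forall t, 0 <= t <= T -> `|Y t w| <= M).
Context (L1Y : in_L1 QQ (Ystar T Y)) (cfa : cont_from_above_at0 P T Y QQ).

Let mYs := measurable_Ystar T0 filtF adY rcY bdY.
Let Ys0 := Ystar_ge0 T0 bdY.

Lemma stopped_dominated tau : stopping_time T F tau ->
  dominated T Y 1 (stopped Y tau).
Proof.
move=> st; split; first exact: measurable_stopped st.
by move=> w; rewrite mul1r (le_trans (stopped_le bdY w st))// lerDl.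
Qed.

Lemma stopping_time0 : stopping_time T F (fun=> 0).
Proof.
split => [w|t ht]; first by rewrite lexx ltW.
rewrite (_ : [set _ | _] = setT).
  by have [F0 FC _] := filtF.1 t ht; rewrite -(setD0 setT); exact: FC.
by apply/seteqP; split => // w _ /=; case/andP: ht.
Qed.

Lemma robust_integrable K X Q : QQ Q -> dominated T Y K X ->
  Q.-integrable setT (EFin \o X).
Proof. exact: dominated_integrable. Qed.

(** Assumption (A) speaks of nonzero times with finite range only; this carries it to all stopping
    times, with an error uniform over [QQ]. *)
Lemma finite_stopping_approx tau delta : stopping_time T F tau -> 0 < delta ->
  exists tau', [/\ finite_stopping_time T F tau', ~ (forall w, tau' w = 0) &
    forall Q, QQ Q ->
      \int[Q]_w `|stopped Y tau' w - stopped Y tau w| <= delta].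
Proof.
move=> st d0; have dt := stopped_dominated st.
have dX n := dominatedB (stopped_dominated (grid_stopping T0 filtF n st).1) dt.
have cv : {ae P, forall w, (stopped Y (fun w => grid T n (tau w)) w -
    stopped Y tau w) @[n --> \oo] --> (0 : R)}.
  apply: aeW => w; rewrite -(subrr (stopped Y tau w)).
  apply: cvgB; last exact: cvg_cst.
  exact: (stopped_grid_cvg T0 rcY st).
have [n hn] := robust_dominated_cvg mYs Ys0 L1Y cfa dX cv d0.
exists (fun w => grid T n (tau w)); split => //; first exact: grid_stopping.
by move=> /(_ point)/eqP; rewrite gt_eqF// grid_gt0.
Qed.

Lemma RintegralB_le K L X Z Q delta : QQ Q -> dominated T Y K X ->
  dominated T Y L Z -> \int[Q]_w `|X w - Z w| <= delta ->
  `|\int[Q]_w X w - \int[Q]_w Z w| <= delta.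
Proof.
move=> QQQ dX dZ; apply: le_trans.
rewrite -RintegralB//; [|exact: robust_integrable dX|exact: robust_integrable dZ].
by apply: le_normr_Rintegral => //; exact: robust_integrable (dominatedB dX dZ).
Qed.

Lemma Rintegral_mix K X Z Q lam : QQ Q -> dominated T Y K X ->
  dominated T Y K Z ->
  \int[Q]_w ((1 - lam) * X w + lam * Z w) =
  (1 - lam) * \int[Q]_w X w + lam * \int[Q]_w Z w.
Proof.
move=> QQQ dX dZ.
have iX := robust_integrable QQQ dX; have iZ := robust_integrable QQQ dZ.
rewrite RintegralD//; first by rewrite !RintegralZl.
- exact: robust_integrable QQQ (dominated_scale (1 - lam) dX).
- exact: robust_integrable QQQ (dominated_scale lam dZ).
Qed.

Context (lam : R) (lam01 : 0 < lam < 1).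
Context (HA : forall tau1 tau2 : Omega -> R,
  finite_stopping_time T F tau1 -> ~ (forall w, tau1 w = 0) ->
  finite_stopping_time T F tau2 -> ~ (forall w, tau2 w = 0) ->
  (ereal_inf [set rhoQ QQ (fun w => (((\1_A w : R) - lam) *
                (stopped Y tau2 w - stopped Y tau1 w))%R)
    | A in stopped_sigma T F (fun w => Order.min (tau1 w) (tau2 w))] <= 0)%E).

(* [1_A - lam] times [Y_t1 - Y_t2] is the mixture of [Y_t1] and [Y_t2] minus the
   pasted payoff, so (A) is used for the pair [(t2, t1)]. *)
Lemma paste_concave tau1 tau2 delta : stopping_time T F tau1 ->
  stopping_time T F tau2 -> 0 < delta ->
  exists2 tau, stopping_time T F tau & forall Q, QQ Q ->
    (1 - lam) * \int[Q]_w stopped Y tau1 w + lam * \int[Q]_w stopped Y tau2 w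
      - delta <= \int[Q]_w stopped Y tau w.
Proof.
move=> st1 st2 d0; have d20 : 0 < delta / 2 by rewrite divr_gt0.
have [t1 [ft1 n1 h1]] := finite_stopping_approx st1 d20.
have [t2 [ft2 n2 h2]] := finite_stopping_approx st2 d20.
have d20' : (0 < (delta / 2)%:E)%E by rewrite lte_fin.
have [_ [A sA <-] hA] := ereal_inf_lt (le_lt_trans (HA ft2 n2 ft1 n1) d20').
have sA' : stopped_sigma T F (fun w => Order.min (t1 w) (t2 w)) A.
  by under eq_fun do rewrite minC.
have st := paste_stopping filtF ft1.1 ft2.1 sA'.
exists (fun w => if w \in A then t2 w else t1 w) => // Q QQQ.
set tau := (fun w => _) in st *.
have dt1 := stopped_dominated ft1.1; have dt2 := stopped_dominated ft2.1.
have dt := stopped_dominated st.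
have dmix := dominatedD (dominated_scale (1 - lam) dt1) (dominated_scale lam dt2).
have hX : (fun w => (\1_A w - lam) * (stopped Y t1 w - stopped Y t2 w)) =
   (fun w => (1 - lam) * stopped Y t1 w + lam * stopped Y t2 w - stopped Y tau w).
  apply/funext => w; rewrite /stopped /tau indicE.
  by case: ifP => _ /=; ring.
rewrite hX in hA.
have : (\int[Q]_w ((1 - lam) * stopped Y t1 w + lam * stopped Y t2 w -
    stopped Y tau w)%:E < (delta / 2)%:E)%E.
  by apply: le_lt_trans hA; apply: ereal_sup_ubound; exists Q.
rewrite (dominated_EFin mYs L1Y QQQ (dominatedB dmix dt)) lte_fin.
rewrite RintegralB//; [|exact: robust_integrable dmix|exact: robust_integrable dt].
rewrite (Rintegral_mix lam QQQ dt1 dt2).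
have := RintegralB_le QQQ dt1 (stopped_dominated st1) (h1 _ QQQ).
have := RintegralB_le QQQ dt2 (stopped_dominated st2) (h2 _ QQQ).
rewrite !ler_norml => /andP[k2 _] /andP[k1 _].
have /andP[l0 l1] := lam01; have l1' : 0 <= 1 - lam by rewrite subr_ge0 ltW.
have := ler_wpM2l l1' k1; have := ler_wpM2l (ltW l0) k2; lra.
Qed.

(** Pasting costs an error, so stopped payoffs themselves need not be stable under [mix]; the slack
    [delta] absorbs it. One [tau] has to serve all [Q]. *)
Definition attainable : set (Omega -> R) :=
  [set g | dominated T Y 1 g /\ forall delta, 0 < delta ->
    exists2 tau, stopping_time T F tau & forall Q, QQ Q ->
      \int[Q]_w g w - delta <= \int[Q]_w stopped Y tau w].

Definition mix (g h : Omega -> R) w : R := (1 - lam) * g w + lam * h w.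

Lemma attainable_stopped tau :
  stopping_time T F tau -> attainable (stopped Y tau).
Proof.
move=> st; split; first exact: stopped_dominated.
by move=> delta d0; exists tau => // Q _; rewrite gerBl ltW.
Qed.

Lemma attainable_mix g h : attainable g -> attainable h -> attainable (mix g h).
Proof.
move=> [dg hg] [dh hh]; have /andP[l0 l1] := lam01.
have l1' : 0 <= 1 - lam by rewrite subr_ge0 ltW.
split.
  have := dominatedD (dominated_scale (1 - lam) dg) (dominated_scale lam dh).
  by rewrite ger0_norm// ger0_norm ?(ltW l0)// -mulrDl subrK mul1r.
(* One half of [delta] goes to attaining [g] and [h], the other to pasting. *)
move=> delta d0; have d20 : 0 < delta / 2 by rewrite divr_gt0.
have [t1 st1 h1] := hg _ d20; have [t2 st2 h2] := hh _ d20.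
have [t st ht] := paste_concave st1 st2 d20.
exists t => // Q QQQ; rewrite (Rintegral_mix lam QQQ dg dh).
have := ht _ QQQ; have := ler_wpM2l l1' (h1 _ QQQ).
have := ler_wpM2l (ltW l0) (h2 _ QQQ); lra.
Qed.

Lemma finite_lower_bound n (s : 'I_n -> probability Omega R) c delta :
  (forall i, QQ (s i)) ->
  (forall w : 'I_n -> R, (forall i, 0 <= w i) -> \sum_(i < n) w i = 1 ->
    exists2 tau, stopping_time T F tau &
      c <= \sum_(i < n) w i * \int[s i]_x stopped Y tau x) ->
  0 < delta ->
  exists2 g, attainable g & forall i, c - delta <= \int[s i]_x g x.
Proof.
move=> Qs hw d0.
pose f i (g : {g | attainable g}) := \int[s i]_x sval g x.
have dYs : dominated T Y 1 (fun w => Ystar T Y w + 1).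
  split; first exact: measurable_funD.
  by move=> w; rewrite mul1r ger0_norm// addr_ge0.
(* Summing over [i] gives one bound valid for every index. *)
pose B := \sum_(i < n) \int[s i]_x (Ystar T Y x + 1).
have fB i g : `|f i g| <= B.
  case: g => g [dg ag]; rewrite /f /=.
  apply: (@le_trans _ _ (\int[s i]_x (Ystar T Y x + 1))).
    apply: le_trans (le_normr_Rintegral _ (robust_integrable (Qs i) dg)) _ => //.
    apply: le_Rintegral => //.
    - exact: robust_integrable (dominated_norm dg).
    - exact: robust_integrable dYs.
    - by move=> w _; have := dg.2 w; rewrite mul1r.
  rewrite /B (bigD1 i)//= lerDl; apply: sumr_ge0 => j _.
  by apply: Rintegral_ge0 => w _; rewrite addr_ge0.
have [] := @concavelike_alternative R {g | attainable g} n f lam B c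
  (exist _ _ (attainable_stopped stopping_time0)) lam01 fB _ _ delta d0.
- move=> [u au] [v av]; exists (exist _ _ (attainable_mix au av)) => i.
  by rewrite /f /= /mix (Rintegral_mix lam (Qs i) au.1 av.1).
- move=> w w0 w1; have [tau st h] := hw w w0 w1.
  by exists (exist _ _ (attainable_stopped st)).
- by move=> [g ag] h; exists g.
Qed.

Lemma uniform_lower_bound c delta :
  (forall n (s : 'I_n -> probability Omega R) (w : 'I_n -> R),
    (forall i, QQ (s i)) -> (forall i, 0 <= w i) -> \sum_(i < n) w i = 1 ->
    exists2 tau, stopping_time T F tau &
      c <= \sum_(i < n) w i * \int[s i]_x stopped Y tau x) ->
  0 < delta ->
  exists2 tau, stopping_time T F tau & forall Q, QQ Q ->
    c - delta <= \int[Q]_x stopped Y tau x.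
Proof.
(* The thirds pay for feasibility on finite families, for the passage from [h] to [g], and for
   replacing [g] by a stopped payoff. *)
move=> hw d0; have d30 : 0 < delta / 3 by rewrite divr_gt0.
have /andP[l0 l1] := lam01; have l1' : 0 < 1 - lam by rewrite subr_gt0.
(* [1 + 1] is the domination constant of a difference of two attainable payoffs. *)
have [eta eta0 heta] := robust_small_energy mYs Ys0 L1Y cfa (1 + 1) d30.
have [||||||g ag hg] := @uniform_near_feasible R (probability Omega R)
  (Omega -> R) QQ attainable (fun Q g => \int[Q]_x g x) (energy P T Y)
  (fun g h => energy P T Y (fun x => g x - h x)) mix (c - delta / 3)
  ((1 - lam) * lam) 1 _ _ _ _ _ _ eta eta0.
- by rewrite mulr_gt0.
- by move=> g [dg _]; rewrite energy_ge0 -(expr1n _ 2) (energy_le P mYs Ys0 dg).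
- exact: attainable_mix.
- move=> Q g h QQQ [dg _] [dh _] cg ch; rewrite (Rintegral_mix lam QQQ dg dh).
  have := ler_wpM2l (ltW l1') cg; have := ler_wpM2l (ltW l0) ch; lra.
- move=> g h m [dg _] [dh _] gm hm; rewrite (energy_mix P mYs Ys0 lam dg dh).
  have := ler_wpM2l (ltW l1') gm; have := ler_wpM2l (ltW l0) hm; lra.
- by move=> n s Qs; apply: finite_lower_bound => // w; exact: hw.
have [tau st ht] := ag.2 _ d30; exists tau => // Q QQQ.
have [h [[dh _] ch gh]] := hg Q QQQ.
have := RintegralB_le QQQ ag.1 dh (heta _ (dominatedB ag.1 dh) gh Q QQQ).
by rewrite ler_norml => /andP[+ _]; have := ht Q QQQ; lra.
Qed.

End minimax.

(** * The minimax identity *)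

Theorem theorem5p1 (d : measure_display) (Omega : measurableType d) (R : realType)
  (T : R) (P : probability Omega R) (F : R -> set (set Omega))
  (QQ : set (probability Omega R)) (Y : R -> Omega -> R) :
  0 < T ->
  filtration T F ->
  right_continuous_filtration T F ->
  F T = measurable ->
  (forall A, F 0 A -> P A = 0%E \/ P A = 1%E) ->
  (forall A, measurable A -> P A = 0%E -> F 0 A) ->
  QQ !=set0 ->
  (forall Q, QQ Q -> abs_cont Q P) ->
  (* Y adapted *)
  (forall t, 0 <= t <= T -> forall B, measurable B -> F t (Y t @^-1` B)) ->
  (* right-continuous paths *)
  (forall w t, 0 <= t < T -> Y ^~ w x @[x --> t^'+] --> Y t w) ->
  (* bounded paths *)
  (forall w, exists M : R, forall t, 0 <= t <= T -> `|Y t w| <= M) ->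
  (* quasi left-upper-semicontinuity w.r.t. P *)
  (forall (taun : nat -> Omega -> R) (tau : Omega -> R),
     (forall n, stopping_time T F (taun n)) -> stopping_time T F tau ->
     (forall w n, taun n w <= taun n.+1 w) ->
     (forall w, taun n w @[n --> \oo] --> tau w) ->
     {ae P, forall w, (limn_esup (fun n => (Y (taun n w) w)%:E) <= (Y (tau w) w)%:E)%E}) ->
  in_L1 QQ (Ystar T Y) ->
  cont_from_above_at0 P T Y QQ ->
  (* assumption (A) *)
  (exists lambda : R, 0 < lambda < 1 /\
     forall tau1 tau2 : Omega -> R,
       finite_stopping_time T F tau1 -> ~ (forall w, tau1 w = 0) ->
       finite_stopping_time T F tau2 -> ~ (forall w, tau2 w = 0) ->
       (ereal_inf [set rhoQ QQ (fun w => (((\1_A w : R) - lambda) *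
                                          (stopped Y tau2 w - stopped Y tau1 w))%R)
                  | A in stopped_sigma T F (fun w => Order.min (tau1 w) (tau2 w))]
        <= 0)%E) ->
  let E := fun (Q : probability Omega R) (tau : Omega -> R) =>
             (\int[Q]_w (stopped Y tau w)%:E)%E in
  ereal_sup [set ereal_inf [set E Q tau | Q in QQ] | tau in stopping_time T F]
  = ereal_sup [set ereal_inf [set E Q tau | Q in co QQ] | tau in stopping_time T F]
  /\
  ereal_sup [set ereal_inf [set E Q tau | Q in co QQ] | tau in stopping_time T F]
  = ereal_inf [set ereal_sup [set E Q tau | tau in stopping_time T F] | Q in co QQ].
Proof.
move=> T0 filtF _ _ _ _ [Q0 QQ0] _ adY rcY bdY _ L1Y cfa [lam [lam01 HA]] E.
have mYs := measurable_Ystar T0 filtF adY rcY bdY.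
have ds tau : stopping_time T F tau -> dominated T Y 1 (stopped Y tau).
  exact: (stopped_dominated T0 filtF adY rcY bdY).
have EQ Q tau : QQ Q -> stopping_time T F tau ->
    E Q tau = (\int[Q]_w stopped Y tau w)%:E.
  by move=> QQQ st; exact: (dominated_EFin mYs L1Y QQQ (ds _ st)).
have Emix n (w : 'I_n -> R) (s : 'I_n -> probability Omega R)
    (mu : probability Omega R) tau :
    (forall i, 0 <= w i) -> (forall i, QQ (s i)) ->
    (forall A, measurable A -> mu A = (\sum_(i < n) (w i)%:E * s i A)%E) ->
    stopping_time T F tau ->
    E mu tau = (\sum_(i < n) w i * \int[s i]_x stopped Y tau x)%:E.
  move=> w0 Qs muE st; apply: (integral_mixture w0 muE).
    by move=> i; exact: (dominated_integrable mYs L1Y (Qs i) (ds _ st)).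
  exact: (ds _ st).1.
have co_sub : QQ `<=` co QQ.
  move=> Q QQQ; exists 1%N, (fun=> 1), (fun=> Q).
  split=> //; rewrite big_ord1; do 2!split=> //.
  by move=> A _; rewrite big_ord1 mul1e.
have infE tau : stopping_time T F tau ->
    ereal_inf [set E Q tau | Q in QQ] = ereal_inf [set E Q tau | Q in co QQ].
  move=> st; apply/eqP; rewrite eq_le; apply/andP; split; last first.
    by apply: ereal_inf_le_tmp => _ [Q QQQ <-]; exists Q => //; exact: co_sub.
  (* Under a mixture the expectation is an average of expectations under members of [QQ], so it
     cannot fall below their infimum. *)
  apply: le_ereal_inf_tmp => _ [mu [n [w [s [w0 [w1 [Qs muE]]]]]] <-].
  rewrite (Emix _ _ _ _ _ w0 Qs muE st).
  have lb Q : QQ Q -> (ereal_inf [set E Q tau | Q in QQ] <= (\int[Q]_x stopped Y tau x)%:E)%E.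
    by move=> QQQ; rewrite -EQ//; apply: ereal_inf_lbound; exists Q.
  (* The value [-oo] is trivial, and [+oo] is excluded by the finite expectation under [Q0]. *)
  case: (ereal_inf _) lb => [r lb| |_]; last exact: leNye.
    rewrite lee_fin -[r]mul1r -w1 mulr_suml; apply: ler_sum => i _.
    by rewrite ler_wpM2l// -lee_fin; exact: lb.
  by move=> /(_ _ QQ0).
have sup_infE : ereal_sup [set ereal_inf [set E Q tau | Q in QQ] | tau in stopping_time T F]
  = ereal_sup [set ereal_inf [set E Q tau | Q in co QQ] | tau in stopping_time T F].
  by congr ereal_sup; apply/seteqP; split=> _ [tau st <-]; exists tau => //; rewrite infE.
split=> //; apply/eqP; rewrite eq_le; apply/andP; split.
  apply: ge_ereal_sup => _ [tau st <-]; apply: le_ereal_inf_tmp => _ [mu comu <-].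
  apply: (@le_trans _ _ (E mu tau)); first by apply: ereal_inf_lbound; exists mu.
  by apply: ereal_sup_ubound; exists tau.
rewrite -sup_infE; set c := ereal_inf _; set a := ereal_sup _.
have c_le mu : co QQ mu -> (c <= ereal_sup [set E mu tau | tau in stopping_time T F])%E.
  by move=> comu; apply: ereal_inf_lbound; exists mu.
(* All stopped payoffs have expectation under [Q0] at most that of [Ystar + 1]; with [-oo] being
   trivial, [c] may then be taken real. *)
have c_lty : (c < +oo)%E.
  apply: le_lt_trans (c_le _ (co_sub _ QQ0)) _.
  have dY : dominated T Y 1 (fun w => Ystar T Y w + 1).
    split; first exact: measurable_funD.
    by move=> w; rewrite mul1r ger0_norm// addr_ge0// (Ystar_ge0 T0 bdY).
  apply: (@le_lt_trans _ _ (\int[Q0]_w (Ystar T Y w + 1))%:E); last exact: ltry.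
  apply: ge_ereal_sup => _ [tau st <-]; rewrite EQ// lee_fin.
  apply: le_Rintegral => //.
  - exact: (dominated_integrable mYs L1Y QQ0 (ds _ st)).
  - exact: (dominated_integrable mYs L1Y QQ0 dY).
  - by move=> w _; have := (ds _ st).2 w; rewrite mul1r; apply: le_trans (ler_norm _).
case: c c_le c_lty => [r c_le _|//|_ _]; last exact: leNye.
apply/lee_addgt0Pr => e e0; rewrite -leeBlDr// -EFinB.
have e20 : 0 < e / 2 by rewrite divr_gt0.
have [|tau st h] := uniform_lower_bound T0 filtF adY rcY bdY L1Y cfa lam01 HA
    (c := r - e / 2) _ e20.
  (* The weights define a measure in [co QQ]. Its optimal stopping value is at least [r], so some
     [tau] exceeds [r - e / 2]; the other half of [e] is the error of [uniform_lower_bound]. *)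
  move=> n s w Qs w0 w1; have [mu muE] := mixture_exists s w0 w1.
  have comu : co QQ mu by exists n, w, s; split=> //; split=> //; split=> // A _.
  have : ((r - e / 2)%:E < ereal_sup [set E mu tau | tau in stopping_time T F])%E.
    by apply: lt_le_trans (c_le _ comu); rewrite lte_fin ltrBlDr ltrDl.
  move=> /ereal_sup_gt[_ [tau st <-]].
  rewrite (Emix _ _ _ _ _ w0 Qs (fun A _ => muE A) st) lte_fin => h.
  by exists tau => //; exact: ltW.
apply: (@le_trans _ _ (ereal_inf [set E Q tau | Q in QQ])).
  apply: le_ereal_inf_tmp => _ [Q QQQ <-]; rewrite EQ// lee_fin.
  by apply: le_trans (h Q QQQ); lra.
by apply: ereal_sup_ubound; exists tau.
Qed.
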